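(* Let $\Lambda$ be a rank-$3$ lattice in $\mathbb{E}^3$ preserved by the group $[3,4]$. Then there exists $a\in\mathbb{R}\setminus\{0\}$ such that $$a^{-1}\Lambda\in\{\Lambda_{(1,0,0)},\Lambda_{(1,1,1)},\Lambda_{(1,1,0)}\}.$$
   Context: A rank-$3$ lattice in $\mathbb{E}^3$ is the set of integer linear combinations of three linearly independent vectors. $[3,4]$ denotes the octahedral group, the symmetry group of the octahedron with vertices $\pm e_1,\pm e_2,\pm e_3$, generated by the isometries $(x,y,z)\mapsto(y,x,z)$, $(x,y,z)\mapsto(x,z,y)$ and $(x,y,z)\mapsto(x,y,-z)$. A lattice is preserved by a group of linear isometries if every element of the group maps the lattice to itself. $\Lambda_{(1,0,0)}=\mathbb{Z}^3$; $\Lambda_{(1,1,1)}$ is the set of integral vectors all of whose coordinates have the same parity; $\Lambda_{(1,1,0)}$ is the set of integral vectors whose coordinate sum is even. *)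

(* Defs.v *)
From HB Require Import structures.
From mathcomp Require Import all_boot all_order all_algebra.
From mathcomp Require Import classical_sets reals.

Set Implicit Arguments.
Unset Strict Implicit.
Unset Printing Implicit Defensive.

Import Order.TTheory GRing.Theory Num.Theory.

Local Open Scope classical_set_scope.
Local Open Scope ring_scope.

Definition vec3 (R : realType) (x y z : R) : 'rV[R]_3 :=
  \row_(i < 3) [:: x; y; z]`_i.

(* The rows of [B] are the three linearly independent generating vectors. *)
Definition rank3_lattice (R : realType) (L : set 'rV[R]_3) : Prop :=
  exists2 B : 'M[R]_3, row_free B &
    L = [set \sum_(i < 3) (c i)%:~R *: row i B | c in [set: 'I_3 -> int]].

Definition swap_xy (R : realType) (v : 'rV[R]_3) : 'rV[R]_3 :=
  vec3 (v 0 1) (v 0 0) (v 0 2).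

Definition swap_yz (R : realType) (v : 'rV[R]_3) : 'rV[R]_3 :=
  vec3 (v 0 0) (v 0 2) (v 0 1).

Definition neg_z (R : realType) (v : 'rV[R]_3) : 'rV[R]_3 :=
  vec3 (v 0 0) (v 0 1) (- v 0 2).

Inductive octahedral_group (R : realType) : set ('rV[R]_3 -> 'rV[R]_3) :=
| oct_swap_xy : octahedral_group (@swap_xy R)
| oct_swap_yz : octahedral_group (@swap_yz R)
| oct_neg_z : octahedral_group (@neg_z R)
| oct_id : octahedral_group id
| oct_comp f g :
    octahedral_group f -> octahedral_group g -> octahedral_group (f \o g)
| oct_inv f g :
    octahedral_group f -> cancel f g -> cancel g f -> octahedral_group g.

Definition preserved_by (R : realType) (G : set ('rV[R]_3 -> 'rV[R]_3))
    (L : set 'rV[R]_3) : Prop :=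
  forall g, G g -> g @` L = L.

Definition Lambda100 (R : realType) : set 'rV[R]_3 :=
  [set map_mx intr z | z in [set: 'rV[int]_3]].

Definition Lambda111 (R : realType) : set 'rV[R]_3 :=
  [set map_mx intr z | z in
    [set z : 'rV[int]_3 | forall i j, (z 0%R i = z 0%R j %[mod 2])%Z]].

Definition Lambda110 (R : realType) : set 'rV[R]_3 :=
  [set map_mx intr z | z in
    [set z : 'rV[int]_3 | (2 %| (\sum_(i < 3) z 0 i)%R)%Z]].

Arguments octahedral_group R : clear implicits.
Arguments Lambda100 R : clear implicits.
Arguments Lambda111 R : clear implicits.
Arguments Lambda110 R : clear implicits.

(* Main.v *)
Require Import Defs.
From HB Require Import structures.
From mathcomp Require Import all_boot all_order all_algebra.
From mathcomp Require Import classical_sets reals.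
From mathcomp Require Import boolp zify.

Set Implicit Arguments.
Unset Strict Implicit.
Unset Printing Implicit Defensive.

Import Order.TTheory GRing.Theory Num.Theory.

Local Open Scope classical_set_scope.
Local Open Scope ring_scope.

(** Let [A] be the set of the reals [t] with [(t, 0, 0)] in the lattice [L].
    Some coordinate, relative to a basis of [L], is a nonzero linear form on the
    first axis and takes integer values on [L]; so [A] is a discrete subgroup of
    the line, that is, [A] consists of the integer multiples of a number [d]
    ([discrete_subgroup_cyclic]).

    Subtracting from [(x, y, z)] its mirror image [(x, y, - z)] leaves
    [(0, 0, 2 z)].  Hence every coordinate of a vector of [L] is half of an
    element of [A] ([double_coord]), which gives [d != 0], and [L] becomes,
    after rescaling by [d / 2], a group [M] of integer triples that contains
    [2 Z^3] but not [(1, 0, 0)].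

    Such an [M] is determined by its image in [F_2^3], a subspace that is
    stable under permutations and contains no vector of weight 1.  It cannot
    contain vectors both of weight 2 and of weight 3, because their sum has
    weight 1.  So the weights that occur are 0 alone, 0 and 3, or 0 and 2
    ([octahedral_int_classification]); these are the multiples by 2 of
    [Lambda100], then [Lambda111] and [Lambda110]. *)

(** * Cyclic subgroups of the line *)

Lemma subgroup_mulz (V : zmodType) (S : set V) (x : V) (n : int) :
  S 0 -> (forall u v, S u -> S v -> S (u - v)) -> S x -> S (x *~ n).
Proof.
move=> S0 SB Sx.
have SN u : S u -> S (- u) by move=> Su; rewrite -sub0r; apply: SB.
have SM k : S (x *+ k).
  elim: k => [|k IHk]; first by rewrite mulr0n.
  by rewrite mulrS -[x *+ k]opprK; apply: SB => //; apply: SN.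
by case: n => k; [exact: SM | exact/SN/SM].
Qed.

(** The generator is the least positive element, when there is one:
    the remainder of a division by it stays in the subgroup. *)
Lemma int_subgroup_cyclic (S : set int) :
  S 0 -> (forall m n, S m -> S n -> S (m - n)) ->
  exists d : int, forall n, S n <-> (d %| n)%Z.
Proof.
move=> S0 SB.
have SM (m n : int) : S m -> S (m * n) by rewrite -mulrzz; exact: subgroup_mulz.
have [[n Sn n0]|none] := pselect (exists2 n : int, S n & n != 0); last first.
  exists 0 => n; rewrite dvd0z; split=> [Sn|/eqP -> //].
  by apply/negP => /negP n0; apply: none; exists n.
have ex : exists k : nat, (0 < k)%N && `[< S k%:Z >].
  exists `|n|%N; rewrite absz_gt0 n0; apply/asboolP.
  have [->|->] : (`|n|%N : int) = n * 1 \/ (`|n|%N : int) = n * -1 by lia.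
    exact: SM.
  exact: SM.
case: (ex_minnP ex) => k /andP[k0 /asboolP Sk] kmin.
exists k%:Z => m; split=> [Sm|/dvdzP[q ->]]; last by rewrite mulrC; apply: SM.
have Sr : S (m %% k%:Z)%Z.
  have -> : (m %% k%:Z)%Z = m - k%:Z * (m %/ k%:Z)%Z by lia.
  by apply: SB => //; apply: SM.
have r_ge0 : 0 <= (m %% k%:Z)%Z by apply: modz_ge0; lia.
have r_lt : (m %% k%:Z)%Z < k%:Z by apply: ltz_pmod; lia.
apply/dvdz_mod0P; apply: contrapT => /eqP r0.
move: Sr r0 r_ge0 r_lt; case: (m %% k%:Z)%Z => // r Sr r0 _ r_lt.
have : (k <= r)%N by apply: kmin; apply/andP; split; [lia | exact/asboolP].
by lia.
Qed.

(** Discreteness of [A] is expressed by an integrality condition, which is the form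
    in which a basis of a lattice provides it. *)
Lemma discrete_subgroup_cyclic (F : numFieldType) (A : set F) (w : F) :
  A 0 -> (forall s t, A s -> A t -> A (s - t)) -> w != 0 ->
  (forall t, A t -> exists n : int, t * w = n%:~R) ->
  exists d, forall t, A t <-> exists n : int, t = d * n%:~R.
Proof.
move=> A0 AB w0 Aint.
have [|m n Sm Sn|d dP] := @int_subgroup_cyclic (fun n => A (n%:~R / w)).
- by rewrite mul0r.
- by rewrite rmorphB mulrBl; apply: AB.
exists (d%:~R / w) => t; split=> [At|[n ->]].
  have [n tE] := Aint t At.
  have tE' : t = n%:~R / w by rewrite -tE mulfK.
  move: At; rewrite tE' => /dP /dvdzP[q ->]; exists q.
  by rewrite [RHS]mulrC mulrA rmorphM.
by rewrite mulrAC -rmorphM /=; apply/dP/dvdz_mulr.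
Qed.

(** * Groups of triples with octahedral symmetry *)

(** The coefficients range over any additive group, so that the notion covers
    both the real lattice and the integer triples obtained by rescaling it. *)
Record octahedral_subgroup (V : zmodType) (P : V -> V -> V -> Prop) : Prop := {
  oct0 : P 0 0 0;
  octB : forall x y z x' y' z',
    P x y z -> P x' y' z' -> P (x - x') (y - y') (z - z');
  octxy : forall x y z, P x y z -> P y x z;
  octyz : forall x y z, P x y z -> P x z y;
  octNz : forall x y z, P x y z -> P x y (- z) }.

Lemma octahedral_subgroup_preim (U V : zmodType) (f : U -> V)
    (P : V -> V -> V -> Prop) :
  {morph f : x y / x - y} -> octahedral_subgroup P ->
  octahedral_subgroup (fun x y z => P (f x) (f y) (f z)).
Proof.
move=> fB [P0 PB Pxy Pyz PNz].
have f0 : f 0 = 0 by rewrite -(subrr 0) fB subrr.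
split=> [|x y z x' y' z'|x y z|x y z|x y z].
- by rewrite f0.
- by rewrite !fB; apply: PB.
- exact: Pxy.
- exact: Pyz.
- by rewrite -[- z]sub0r fB f0 sub0r; apply: PNz.
Qed.

Section OctahedralSubgroup.
Variables (V : zmodType) (P : V -> V -> V -> Prop).
Hypothesis octP : octahedral_subgroup P.

Lemma octD x y z x' y' z' :
  P x y z -> P x' y' z' -> P (x + x') (y + y') (z + z').
Proof.
move=> Pv Pv'; rewrite -[x']opprK -[y']opprK -[z']opprK.
apply: (octB octP) => //.
by have := octB octP (oct0 octP) Pv'; rewrite !sub0r.
Qed.

Lemma octxz x y z : P x y z -> P z y x.
Proof. by move=> /(octxy octP)/(octyz octP)/(octxy octP). Qed.

(** A vector minus its mirror image in a coordinate plane lies on an axis. *)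
Lemma double_coord x y z :
  P x y z -> [/\ P (x + x) 0 0, P (y + y) 0 0 & P (z + z) 0 0].
Proof.
have dbl u v w : P u v w -> P (w + w) 0 0.
  move=> Pv; apply: octxz.
  rewrite -[X in P X](subrr u) -[X in P _ X](subrr v) -[X in P _ _ (_ + X)]opprK.
  by apply: (octB octP) => //; apply: (octNz octP).
by move=> Pv; split; [apply: (dbl z y) | apply: (dbl x z) | apply: (dbl x y)];
  [apply: octxz | apply: (octyz octP) | ].
Qed.

Lemma oct_axes x y z : P x 0 0 -> P y 0 0 -> P z 0 0 -> P x y z.
Proof.
move=> Px Py Pz.
have := octD (octD Px (octxy octP Py)) (octxz Pz).
by rewrite !addr0 !add0r.
Qed.

Lemma octDr x y z x' y' z' :
  P x' y' z' -> P (x + x') (y + y') (z + z') <-> P x y z.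
Proof.
move=> Pv'; split=> [Pv|Pv]; last exact: octD.
by have := octB octP Pv Pv'; rewrite !addrK.
Qed.

End OctahedralSubgroup.

Lemma modz2_cases (x : int) : exists q, x = 0 + q * 2 \/ x = 1 + q * 2.
Proof. by exists (x %/ 2)%Z; lia. Qed.

(** Membership depends on the parities only.  The sum of [(1, 1, 0)] and
    [(1, 1, 1)] is [(0, 0, 1)] modulo 2, so at most one of them belongs to
    [P]; the three cases are those left. *)
Lemma octahedral_int_classification (P : int -> int -> int -> Prop) :
  octahedral_subgroup P -> P 2 0 0 -> ~ P 1 0 0 ->
  [\/ forall x y z, P x y z <-> [&& 2 %| x, 2 %| y & 2 %| z]%Z,
      forall x y z, P x y z <->
        (x == y %[mod 2])%Z && (y == z %[mod 2])%Z |
      forall x y z, P x y z <-> (2 %| x + y + z)%Z].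
Proof.
move=> octP P2 nP1.
have Peven q : P (q * 2) 0 0.
  rewrite mulrC -mulrzz.
  apply: (@subgroup_mulz _ (fun t => P t 0 0)) => // [|s t Ps Pt].
    exact: oct0 octP.
  by have := octB octP Ps Pt; rewrite subr0.
have P000 := oct0 octP.
have nP010 : ~ P 0 1 0 by move=> /(octxy octP).
have nP001 : ~ P 0 0 1 by move=> /(octxz octP).
have P101 : P 1 0 1 <-> P 1 1 0 by split=> /(octyz octP).
have P011 : P 0 1 1 <-> P 1 1 0.
  by rewrite -P101; split=> /(octxy octP).
have nP11 : P 1 1 0 -> ~ P 1 1 1.
  by move=> P110 P111; apply: nP001; have := octB octP P111 P110.
have parity x y z p q r :
    P (x + p * 2) (y + q * 2) (z + r * 2) <-> P x y z.
  exact: (octDr octP _ _ _ (oct_axes octP (Peven p) (Peven q) (Peven r))).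
(* Modulo [2 Z^3] and permutations, one triple of each weight is left to
     compare; the hypotheses on [Q] list its values on them. *)
have red (Q : int -> int -> int -> bool) :
    (forall x y z p q r,
      Q (x + p * 2) (y + q * 2) (z + r * 2) <-> Q x y z) ->
    [&& Q 0 0 0, ~~ Q 1 0 0, ~~ Q 0 1 0 & ~~ Q 0 0 1] ->
    [&& Q 1 0 1 == Q 1 1 0 & Q 0 1 1 == Q 1 1 0] ->
    (P 1 1 0 <-> Q 1 1 0) -> (P 1 1 1 <-> Q 1 1 1) ->
  forall x y z, P x y z <-> Q x y z.
  move=> Qpar /and4P[Q0 /negP Q1 /negP Q2 /negP Q3] /andP[/eqP Q101 /eqP Q011].
  move=> Q110 Q111 x y z.
  have [p [->|->]] := modz2_cases x; have [q [->|->]] := modz2_cases y;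
    by have [r [->|->]] := modz2_cases z; rewrite parity Qpar ?Q101 ?Q011; tauto.
have [P110|nP110] := pselect (P 1 1 0).
  have nP111 := nP11 P110.
  by apply: Or33; apply: red => [x y z p q r| | | |] //; lia.
have [P111|nP111] := pselect (P 1 1 1).
  by apply: Or32; apply: red => [x y z p q r| | | |] //; lia.
by apply: Or31; apply: red => [x y z p q r| | | |] //; lia.
Qed.

(** * Lattices as groups of triples *)

Section Coordinates.
Variable R : realType.
Implicit Types (v : 'rV[R]_3) (L : set 'rV[R]_3).

Lemma eq_rV3 (T : Type) (u v : 'rV[T]_3) :
  u 0 0 = v 0 0 -> u 0 1 = v 0 1 -> u 0 2 = v 0 2 -> u = v.
Proof.
move=> e0 e1 e2; apply/rowP => -[[|[|[|//]]] lti].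
- by rewrite (_ : Ordinal lti = 0) //; apply/val_inj.
- by rewrite (_ : Ordinal lti = 1) //; apply/val_inj.
- by rewrite (_ : Ordinal lti = 2) //; apply/val_inj.
Qed.

Lemma vec3_0 (x y z : R) : vec3 x y z 0 0 = x. Proof. by rewrite mxE. Qed.
Lemma vec3_1 (x y z : R) : vec3 x y z 0 1 = y. Proof. by rewrite mxE. Qed.
Lemma vec3_2 (x y z : R) : vec3 x y z 0 2 = z. Proof. by rewrite mxE. Qed.
Definition vec3E := (vec3_0, vec3_1, vec3_2).

Lemma vec3_coord v : vec3 (v 0 0) (v 0 1) (v 0 2) = v.
Proof. by apply: eq_rV3; rewrite vec3E. Qed.

Lemma rank3_lattice_subgroup L : rank3_lattice L ->
  L 0 /\ forall u v, L u -> L v -> L (u - v).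
Proof.
case=> B _ ->; split=> [|_ _ [c _ <-] [c' _ <-]].
  by exists (fun=> 0) => //; rewrite big1 // => i _; rewrite scale0r.
exists (fun i => c i - c' i) => //.
by rewrite -sumrB; apply: eq_bigr => i _; rewrite rmorphB scalerBl.
Qed.

Lemma rank3_lattice_neq0 L : rank3_lattice L -> exists2 v, L v & v != 0.
Proof.
case=> B Bfree ->; exists (row 0 B).
  exists (fun i => (i == 0)%:R) => //.
  rewrite (bigD1 0) //= scale1r big1 ?addr0 // => i /negbTE ->.
  by rewrite scale0r.
apply/eqP; rewrite rowE => dB0.
have : delta_mx 0 0 = 0 :> 'rV[R]_3.
  by apply: (row_free_inj Bfree); rewrite mul0mx.
by move/rowP/(_ 0)/eqP; rewrite !mxE eqxx oner_eq0.
Qed.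

(** The number [w] is a nonzero coordinate of [u] in a basis of the lattice. *)
Lemma rank3_lattice_line L (u : 'rV[R]_3) : rank3_lattice L -> u != 0 ->
  exists2 w : R, w != 0 &
    forall t, L (t *: u) -> exists n : int, t * w = n%:~R.
Proof.
case=> B Bfree -> u0.
have Bunit : B \in unitmx by rewrite -row_free_unit.
have /rV0Pn[j wj] : u *m invmx B != 0.
  by apply: contra_neq u0 => uB; rewrite -(mulmxKV Bunit u) uB mul0mx.
exists ((u *m invmx B) 0 j) => // t [c _ cE]; exists (c j).
have -> : t * (u *m invmx B) 0 j = ((t *: u) *m invmx B) 0 j.
  by rewrite -scalemxAl [in RHS]mxE.
have -> : t *: u = (\row_i (c i)%:~R) *m B.
  by rewrite -cE mulmx_sum_row; apply: eq_bigr => i _; rewrite mxE.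
by rewrite mulmxK // mxE.
Qed.

Lemma preserved_octahedral_subgroup L :
  rank3_lattice L -> preserved_by (octahedral_group R) L ->
  octahedral_subgroup (fun x y z => L (vec3 x y z)).
Proof.
move=> /rank3_lattice_subgroup[L0 LB] hG.
have sym g v : octahedral_group R g -> L v -> L (g v).
  by move=> Gg Lv; rewrite -(hG g Gg); exists v.
split=> [|x y z x' y' z' Lv Lv'|x y z Lv|x y z Lv|x y z Lv].
- by rewrite (_ : vec3 0 0 0 = 0) //; apply: eq_rV3; rewrite vec3E mxE.
- rewrite (_ : vec3 _ _ _ = vec3 x y z - vec3 x' y' z'); first exact: LB.
  by apply: eq_rV3; rewrite !mxE.
- by have := sym _ _ (oct_swap_xy R) Lv; rewrite /swap_xy !vec3E.
- by have := sym _ _ (oct_swap_yz R) Lv; rewrite /swap_yz !vec3E.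
- by have := sym _ _ (oct_neg_z R) Lv; rewrite /neg_z !vec3E.
Qed.

Definition int_triple (p q r : int) : 'rV[int]_3 := \row_i [:: p; q; r]`_i.

(** The classification speaks of coordinates in the unit [b], whereas [2 Z^3]
    becomes [Lambda100] in the unit [2 b] only; the factor [k] converts between
    the two units. *)
Lemma rescaled_lattice L (Q : set 'rV[int]_3) (b : R) (k : int) :
  b != 0 -> k != 0 ->
  (forall v, L v -> exists p q r : int,
     v = vec3 (b * p%:~R) (b * q%:~R) (b * r%:~R)) ->
  (forall p q r : int, L (vec3 (b * p%:~R) (b * q%:~R) (b * r%:~R)) <->
     exists2 z, Q z & [/\ p = k * z 0 0, q = k * z 0 1 & r = k * z 0 2]) ->
  [set (b * k%:~R)^-1 *: v | v in L] = [set map_mx intr z | z in Q].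
Proof.
move=> b0 k0 Lint LQ.
have bk0 : b * k%:~R != 0 by rewrite mulf_neq0 ?intr_eq0.
have scaleE (z : 'rV[int]_3) :
    vec3 (b * (k * z 0 0)%:~R) (b * (k * z 0 1)%:~R) (b * (k * z 0 2)%:~R)
    = (b * k%:~R) *: map_mx intr z.
  by apply: eq_rV3; rewrite !mxE /= rmorphM mulrA.
apply/seteqP; split=> [_ [v Lv <-]|_ [z Qz <-]].
  have [p [q [r vE]]] := Lint v Lv.
  move: Lv; rewrite vE => /LQ[z Qz [-> -> ->]]; exists z => //.
  by rewrite scaleE scalerK.
exists ((b * k%:~R) *: map_mx intr z); last by rewrite scalerK.
by rewrite -scaleE; apply/LQ; exists z.
Qed.

End Coordinates.

Theorem lemma4p2 (R : realType) (L : set 'rV[R]_3)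
  (hL : rank3_lattice L) (hG : preserved_by (octahedral_group R) L) :
  exists2 a : R, a != 0 &
    [set Lambda100 R; Lambda111 R; Lambda110 R]
      [set a^-1 *: v | v in L].
Proof.
have octL := preserved_octahedral_subgroup hL hG.
pose A t := L (vec3 t 0 0).
have e1_neq0 : vec3 1 0 0 != 0 :> 'rV[R]_3.
  by apply/eqP => /rowP/(_ 0)/eqP; rewrite !mxE oner_eq0.
have [w w0 wA] := rank3_lattice_line hL e1_neq0.
have [||t At|d dA] := discrete_subgroup_cyclic (A := A) _ _ w0.
- exact: oct0 octL.
- by move=> s t As At; have := octB octL As At; rewrite subr0.
- apply: wA; rewrite (_ : _ *: _ = vec3 t 0 0) //.
  by apply: eq_rV3; rewrite !mxE /= ?mulr1 ?mulr0.
(* The coordinates of [L] are integer multiples of half the axial period. *)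
pose b := d / 2.
have dE : d = b * 2 by rewrite /b divfK ?pnatr_eq0.
have half t : A (t + t) -> exists n : int, t = b * n%:~R.
  move=> /dA[n tE]; exists n; apply: (@mulIf _ 2); first by rewrite pnatr_eq0.
  by rewrite mulr_natr mulr2n tE dE mulrAC.
have Lint v : L v -> exists p q r : int,
    v = vec3 (b * p%:~R) (b * q%:~R) (b * r%:~R).
  rewrite -{1}(vec3_coord v) => /(double_coord octL)[Ax Ay Az].
  have [p pE] := half _ Ax; have [q qE] := half _ Ay; have [r rE] := half _ Az.
  by exists p, q, r; rewrite -pE -qE -rE vec3_coord.
have b0 : b != 0.
  have [v Lv] := rank3_lattice_neq0 hL; apply: contra_neq => bE.
  have [p [q [r ->]]] := Lint v Lv.
  by rewrite bE !mul0r; apply: eq_rV3; rewrite vec3E mxE.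
pose M (p q r : int) := L (vec3 (b * p%:~R) (b * q%:~R) (b * r%:~R)).
have octM : octahedral_subgroup M.
  apply: (octahedral_subgroup_preim (f := fun n : int => b * n%:~R)) octL.
  by move=> m n; rewrite rmorphB mulrBr.
have M200 : M 2 0 0.
  by rewrite /M !mulr0 -/(A _); apply/dA; exists 1; rewrite mulr1 dE.
have nM100 : ~ M 1 0 0.
  rewrite /M !mulr0 mulr1 -/(A _) => /dA[n]; rewrite dE -mulrA -[LHS]mulr1.
  move/(mulfI b0)/eqP; rewrite -[2]/(2%:~R) -[1]/(1%:~R) -intrM eqr_int.
  by move/eqP; lia.
have [Meven|Mpar|Msum] := octahedral_int_classification octM M200 nM100.
- exists (b * 2%:~R); first by rewrite mulf_neq0 ?intr_eq0.
  left; left; apply: rescaled_lattice => // p q r; rewrite -/(M p q r) Meven.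
  split=> [/and3P[/dvdzP[x ->] /dvdzP[y ->] /dvdzP[z ->]]|[z _ [-> -> ->]]].
    by exists (int_triple x y z) => //; rewrite !mxE /=; split; lia.
  by lia.
- exists (b * 1%:~R); first by rewrite mulr1.
  left; right; apply: rescaled_lattice => // p q r; rewrite -/(M p q r) Mpar.
  split=> [pqr|[z zpar [-> -> ->]]]; last first.
    by rewrite !mul1r; apply/andP; split; apply/eqP; apply: zpar.
  exists (int_triple p q r); last by rewrite !mxE !mul1r.
  by move=> [[|[|[|//]]] ?] [[|[|[|//]]] ?]; rewrite /= !mxE //=; lia.
- exists (b * 1%:~R); first by rewrite mulr1.
  right; apply: rescaled_lattice => // p q r; rewrite -/(M p q r) Msum.
  have sumE (z : 'rV[int]_3) : \sum_i z 0 i = z 0 0 + z 0 1 + z 0 2.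
    rewrite !big_ord_recr big_ord0 /= add0r.
    by congr (z 0 _ + z 0 _ + z 0 _); apply/val_inj.
  split=> [pqr|[z zsum [-> -> ->]]]; last by rewrite !mul1r -sumE.
  exists (int_triple p q r); last by rewrite !mxE !mul1r.
  by rewrite /= sumE !mxE.
Qed.
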